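(* Let $ABC$ be a (nondegenerate) triangle in the Euclidean plane, let $\alpha = \angle BAC$, $\beta = \angle ABC$, and let $H$ be the foot of the altitude from $C$ to the line $(AB)$. Suppose there exist a cevian $AA_1$ issuing from $A$ (with $A_1$ on the line $(BC)$) and a cevian $BB_1$ issuing from $B$ (with $B_1$ on the line $(AC)$) such that $|AA_1| = |BB_1|$ and such that the lines $(AA_1)$ and $(BB_1)$ intersect at a point $O$ of the altitude line $(CH)$. Put $$y = \frac{\overrightarrow{HO}\cdot\overrightarrow{HC}}{|HC|^2}.$$ If $y$ does not satisfy the equation $$y^3 + y(\cot^2\alpha + \cot^2\beta - 1) + 2\cot\alpha\cot\beta = 0,$$ then $ABC$ is isosceles with $AC = BC$.
   Context: A cevian of a triangle is a segment joining a vertex of the triangle to a point that lies on the opposite side or on its extension and is different from the endpoints of that side. $(XY)$ denotes the line through points $X$ and $Y$. Thus $y$ is the signed length of $HO$ measured in units of $|CH|$, positive in the direction of $C$. *)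

(* Defs.v *)
From Stdlib Require Import Reals.
Open Scope R_scope.

(* The Euclidean plane in Cartesian coordinates; the same type serves for
   points and for vectors. *)
Definition point : Type := (R * R)%type.

Definition vec (X Y : point) : point := (fst Y - fst X, snd Y - snd X).

Definition dot (u v : point) : R := fst u * fst v + snd u * snd v.

Definition distance (X Y : point) : R :=
  dist_euc (fst X) (snd X) (fst Y) (snd Y).

(* For X <> Y this is membership of P in the line (XY). If X = Y it only says
   P = X. *)
Definition on_line (X Y P : point) : Prop :=
  exists t : R,
    P = (fst X + t * (fst Y - fst X), snd X + t * (snd Y - snd X)).

Definition nondegenerate (A B C : point) : Prop :=
  A <> B /\ ~ on_line A B C.

(* Measure in [0, PI] of the angle XVY at the vertex V, meaningful when X and Y
   differ from V. *)
Definition angle (X V Y : point) : R :=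
  acos (dot (vec V X) (vec V Y) / (distance V X * distance V Y)).

Definition cot (x : R) : R := cos x / sin x.

Definition altitude_foot (C A B H : point) : Prop :=
  on_line A B H /\ dot (vec C H) (vec A B) = 0.

(* P is the end of a cevian issuing from the vertex opposite to the side XY. *)
Definition cevian_end (X Y P : point) : Prop :=
  on_line X Y P /\ P <> X /\ P <> Y.

(* Main.v *)
Require Import Defs.
From Stdlib Require Import Reals.
From Stdlib Require Import Lra.
Open Scope R_scope.

(** In the orthogonal frame with origin [H], unit length [|HC|] and second axis
    [HC], the points are A = (-a, 0), B = (b, 0), C = (0, 1), O = (0, y), and
    the pair (cot alpha, cot beta) is (a, b) or (-a, -b) according to the
    orientation.  If O = A + t (A1 - A), then t (a + b) = a + b y and
    t^2 |AA1|^2 = a^2 + y^2, and likewise for B with the roles of a and b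
    exchanged.  Hence |AA1| = |BB1| gives
    (a^2 + y^2) (b + a y)^2 = (b^2 + y^2) (a + b y)^2, and the difference of the
    two sides factors as
    (a^2 - b^2) y (y^3 + y (a^2 + b^2 - 1) + 2 a b).
    When y = 0 and the cubic does not vanish, a <> 0, so that the line (AA1) is
    (AB) and A1 = B, which a cevian excludes.  So a^2 = b^2, that is,
    |AC| = |BC|.  The coordinate computation is [cevians_in_frame]; the
    passage to coordinates rests on [altitude_frame] and [cot_angle]. *)

Definition cross (u v : point) : R := fst u * snd v - snd u * fst v.

(** The point with coordinates [(x, z)] in the frame with origin [H] whose
    second axis is the vector [HC] and whose first axis is that vector turned
    clockwise by a right angle. *)
Definition in_frame (H C : point) (x z : R) : point :=
  (fst H + x * (snd C - snd H) + z * (fst C - fst H),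
   snd H - x * (fst C - fst H) + z * (snd C - snd H)).

Lemma distance_nonneg (X Y : point) : 0 <= distance X Y.
Proof. apply sqrt_pos. Qed.

Lemma distance_sq (X Y : point) :
  distance X Y ^ 2 = dot (vec X Y) (vec X Y).
Proof.
  unfold distance, dist_euc, dot, vec; simpl fst; simpl snd.
  rewrite pow2_sqrt; [unfold Rsqr; ring |].
  apply Rplus_le_le_0_compat; apply Rle_0_sqr.
Qed.

Lemma distance_eq_iff_sq (X Y Z T : point) :
  distance X Y = distance Z T <-> distance X Y ^ 2 = distance Z T ^ 2.
Proof.
  split; intro E; [now rewrite E |].
  apply Rsqr_inj; try apply distance_nonneg.
  rewrite !Rsqr_pow2; exact E.
Qed.

Lemma dot_vec_pos (X Y : point) : X <> Y -> 0 < dot (vec X Y) (vec X Y).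
Proof.
  destruct X as [x1 x2], Y as [y1 y2]; unfold dot, vec; simpl; intro N.
  pose proof (Rle_0_sqr (y1 - x1)) as S1; pose proof (Rle_0_sqr (y2 - x2)) as S2.
  fold (Rsqr (y1 - x1)); fold (Rsqr (y2 - x2)).
  destruct (Rtotal_order 0 (Rsqr (y1 - x1) + Rsqr (y2 - x2))) as [P | [P | P]];
    [exact P | | lra].
  exfalso; apply N; f_equal; apply Rminus_diag_uniq_sym, Rsqr_0_uniq; lra.
Qed.

(** * Cotangents of angles *)

Lemma cot_acos (c : R) : -1 <= c <= 1 -> cot (acos c) = c / sqrt (1 - c ^ 2).
Proof.
  intro Hc; unfold cot; rewrite cos_acos, sin_acos by exact Hc.
  now rewrite Rsqr_pow2.
Qed.

Lemma cot_angle (X V Y : point) :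
  cross (vec V X) (vec V Y) <> 0 ->
  cot (angle X V Y) =
  dot (vec V X) (vec V Y) / Rabs (cross (vec V X) (vec V Y)).
Proof.
  intro Hk; unfold angle.
  pose proof (distance_sq V X) as Ep; pose proof (distance_sq V Y) as Eq.
  pose proof (distance_nonneg V X) as Hp; pose proof (distance_nonneg V Y) as Hq.
  set (p := distance V X) in *; set (q := distance V Y) in *.
  set (u := vec V X) in *; set (v := vec V Y) in *.
  (* Lagrange's identity *)
  assert (L : (p * q) ^ 2 = dot u v ^ 2 + cross u v ^ 2).
  { rewrite Rpow_mult_distr, Ep, Eq; unfold dot, cross; ring. }
  assert (Hk2 : 0 < cross u v ^ 2) by (rewrite <- Rsqr_pow2; now apply Rsqr_pos_lt).
  assert (Hpq : 0 < p * q).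
  { assert (0 <= p * q) by (apply Rmult_le_pos; assumption). nra. }
  assert (S : 1 - (dot u v / (p * q)) ^ 2 = (cross u v / (p * q)) ^ 2).
  { apply (Rmult_eq_reg_r ((p * q) ^ 2)); [| nra].
    transitivity ((p * q) ^ 2 - dot u v ^ 2); [field; nra |].
    transitivity (cross u v ^ 2); [rewrite L; ring | field; nra]. }
  assert (Hk3 := pow2_ge_0 (cross u v / (p * q))).
  rewrite cot_acos by nra.
  rewrite S, <- Rsqr_pow2, sqrt_Rsqr_abs.
  unfold Rdiv at 3; rewrite Rabs_mult, (Rabs_pos_eq (/ (p * q))).
  - field; repeat split; try nra. now apply Rabs_no_R0.
  - left; now apply Rinv_0_lt_compat.
Qed.

(** * The frame of an altitude *)

Lemma in_frame_inj (H C : point) (x z x' z' : R) :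
  H <> C -> in_frame H C x z = in_frame H C x' z' -> x = x' /\ z = z'.
Proof.
  intros N E; pose proof (dot_vec_pos H C N) as D; revert D E.
  unfold in_frame, dot, vec; simpl; intros D E; injection E as E1 E2.
  set (f1 := fst C - fst H) in *; set (f2 := snd C - snd H) in *.
  pose proof (f_equal (Rmult f1) E1); pose proof (f_equal (Rmult f2) E1).
  pose proof (f_equal (Rmult f1) E2); pose proof (f_equal (Rmult f2) E2).
  split; apply (Rmult_eq_reg_r (f1 * f1 + f2 * f2)); lra.
Qed.

Lemma distance_sq_in_frame (H C : point) (x z x' z' : R) :
  distance (in_frame H C x z) (in_frame H C x' z') ^ 2 =
  ((x' - x) ^ 2 + (z' - z) ^ 2) * dot (vec H C) (vec H C).
Proof. rewrite distance_sq; unfold in_frame, dot, vec; simpl; ring. Qed.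

Lemma on_line_in_frame (H C : point) (x z x' z' : R) (P : point) :
  on_line (in_frame H C x z) (in_frame H C x' z') P ->
  exists t, P = in_frame H C (x + t * (x' - x)) (z + t * (z' - z)).
Proof.
  intros [t ->]; exists t; unfold in_frame; simpl; f_equal; ring.
Qed.

Lemma in_frame_origin (H C : point) : H = in_frame H C 0 0.
Proof. destruct H; unfold in_frame; simpl; f_equal; ring. Qed.

Lemma in_frame_unit (H C : point) : C = in_frame H C 0 1.
Proof. destruct C; unfold in_frame; simpl; f_equal; ring. Qed.

Lemma altitude_frame (A B C H : point) :
  nondegenerate A B C -> altitude_foot C A B H ->
  H <> C /\
  exists a b, a + b <> 0 /\ A = in_frame H C (- a) 0 /\ B = in_frame H C b 0.
Proof.
  intros [NAB NC] [[k EH] HO].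
  assert (N : H <> C).
  { intros <-; apply NC; now exists k. }
  split; [exact N |].
  pose proof (dot_vec_pos H C N) as D.
  destruct A as [a1 a2], B as [b1 b2], C as [c1 c2], H as [h1 h2].
  unfold in_frame, dot, vec in *; simpl in *; injection EH as E1 E2.
  set (f1 := c1 - h1) in *; set (f2 := c2 - h2) in *.
  assert (P : f1 * (b1 - a1) + f2 * (b2 - a2) = 0) by (subst f1 f2; lra).
  pose proof (f_equal (Rmult f1) P) as P1; pose proof (f_equal (Rmult f2) P) as P2.
  set (d := f1 * f1 + f2 * f2) in *.
  (* [AB] is [m] times the first axis of the frame *)
  set (m := ((b1 - a1) * f2 - (b2 - a2) * f1) / d).
  assert (M1 : b1 - a1 = m * f2).
  { apply (Rmult_eq_reg_r d); [| lra].
    transitivity (((b1 - a1) * f2 - (b2 - a2) * f1) * f2);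
      [unfold d; lra | unfold m; field; lra]. }
  assert (M2 : b2 - a2 = - m * f1).
  { apply (Rmult_eq_reg_r d); [| lra].
    transitivity (- ((b1 - a1) * f2 - (b2 - a2) * f1) * f1);
      [unfold d; lra | unfold m; field; lra]. }
  clearbody m; exists (k * m), ((1 - k) * m); repeat split.
  - intro Z; apply NAB.
    assert (m = 0) by lra; subst m; f_equal; lra.
  - rewrite M1 in E1; rewrite M2 in E2; f_equal; lra.
  - rewrite M1 in E1; rewrite M2 in E2; f_equal; lra.
Qed.

(** The two base angles have cotangents [a] and [b] up to a common sign, which
    is that of [a + b]. *)
Lemma cot_base_angles (H C : point) (a b : R) :
  H <> C -> a + b <> 0 ->
  let A := in_frame H C (- a) 0 in
  let B := in_frame H C b 0 in
  exists e, e ^ 2 = 1 /\ cot (angle B A C) = e * a /\ cot (angle A B C) = e * b.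
Proof.
  intros N Hm A B; pose proof (dot_vec_pos H C N) as D.
  set (d := dot (vec H C) (vec H C)) in *.
  assert (KA : cross (vec A B) (vec A C) = (a + b) * d)
    by (unfold A, B, d, cross, dot, vec, in_frame; simpl; ring).
  assert (DA : dot (vec A B) (vec A C) = (a + b) * a * d)
    by (unfold A, B, d, dot, vec, in_frame; simpl; ring).
  assert (KB : cross (vec B A) (vec B C) = - ((a + b) * d))
    by (unfold A, B, d, cross, dot, vec, in_frame; simpl; ring).
  assert (DB : dot (vec B A) (vec B C) = (a + b) * b * d)
    by (unfold A, B, d, dot, vec, in_frame; simpl; ring).
  assert (Z : (a + b) * d <> 0) by (apply Rmult_integral_contrapositive; lra).
  rewrite !cot_angle by (rewrite ?KA, ?KB; lra).
  rewrite KA, DA, KB, DB, Rabs_Ropp, Rabs_mult, (Rabs_pos_eq d) by lra.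
  clearbody d.
  exists ((a + b) / Rabs (a + b)); unfold Rabs; destruct (Rcase_abs (a + b));
    repeat split; field; lra.
Qed.

(** * Equal cevians meeting on the altitude *)

Lemma equal_cevians_factorization (a b y : R) :
  (a ^ 2 + y ^ 2) * (b + a * y) ^ 2 - (b ^ 2 + y ^ 2) * (a + b * y) ^ 2 =
  (a ^ 2 - b ^ 2) * y * (y ^ 3 + y * (a ^ 2 + b ^ 2 - 1) + 2 * a * b).
Proof. ring. Qed.

(** Here [A1 = (b * (1 - s), s)], [B1 = (- a * (1 - r), r)], and [t], [u] are
    the parameters of [O = (0, y)] on the lines [(AA1)] and [(BB1)]. *)
Lemma cevians_in_frame (a b y s t r u : R) :
  s <> 0 ->
  - a + t * (b * (1 - s) + a) = 0 -> t * s = y ->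
  b + u * (- a * (1 - r) - b) = 0 -> u * r = y ->
  (b * (1 - s) + a) ^ 2 + s ^ 2 = (- a * (1 - r) - b) ^ 2 + r ^ 2 ->
  y ^ 3 + y * (a ^ 2 + b ^ 2 - 1) + 2 * a * b <> 0 ->
  a ^ 2 = b ^ 2.
Proof.
  intros Hs E1 E2 E3 E4 ED NK.
  assert (P1 : a + b * y = t * (a + b)) by (rewrite <- E2; lra).
  assert (P2 : b + a * y = u * (a + b)) by (rewrite <- E4; lra).
  assert (Q1 : a ^ 2 + y ^ 2 = t ^ 2 * ((b * (1 - s) + a) ^ 2 + s ^ 2)).
  { rewrite <- E2. replace a with (t * (b * (1 - s) + a)) at 1 by lra. ring. }
  assert (Q2 : b ^ 2 + y ^ 2 = u ^ 2 * ((- a * (1 - r) - b) ^ 2 + r ^ 2)).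
  { rewrite <- E4. replace b with (- u * (- a * (1 - r) - b)) at 1 by lra. ring. }
  pose proof (equal_cevians_factorization a b y) as F.
  rewrite P1, P2, Q1, Q2, ED in F.
  set (K := y ^ 3 + y * (a ^ 2 + b ^ 2 - 1) + 2 * a * b) in *.
  assert (F0 : (a ^ 2 - b ^ 2) * y * K = 0) by (rewrite <- F; ring).
  apply Rmult_integral in F0 as [F0 | F0]; [| contradiction].
  apply Rmult_integral in F0 as [F0 | F0]; [lra |].
  (* if [y = 0], then [t = 0] because [s <> 0], hence [a = 0] and [K = 0] *)
  exfalso; apply NK.
  rewrite F0 in E2; apply Rmult_integral in E2 as [T | T]; [| contradiction].
  assert (A0 : a = 0) by (rewrite T in E1; lra).
  unfold K; rewrite F0, A0; ring.
Qed.

Theorem mainTheorem4 :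
  forall (A B C H A1 B1 O : point) (alpha beta y : R),
    nondegenerate A B C ->
    alpha = angle B A C ->
    beta = angle A B C ->
    altitude_foot C A B H ->
    cevian_end B C A1 ->
    cevian_end A C B1 ->
    distance A A1 = distance B B1 ->
    on_line A A1 O ->
    on_line B B1 O ->
    on_line C H O ->
    y = dot (vec H O) (vec H C) / distance H C ^ 2 ->
    y ^ 3 + y * (cot alpha ^ 2 + cot beta ^ 2 - 1) + 2 * cot alpha * cot beta <> 0 ->
    distance A C = distance B C.
Proof.
  intros A B C H A1 B1 O alpha beta y ND -> -> AF [LA1 [NA1 _]] [LB1 _] ED
    OA OB OC Hy NK.
  destruct (altitude_frame A B C H ND AF) as [N [a [b [Hm [EA EB]]]]].
  destruct (cot_base_angles H C a b N Hm) as [e [He [CA CB]]].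
  rewrite <- EA, <- EB in CA, CB; rewrite CA, CB in NK.
  pose proof (dot_vec_pos H C N) as D.
  pose proof (in_frame_unit H C) as EC; pose proof (in_frame_origin H C) as EH.
  assert (EO : O = in_frame H C 0 y).
  { destruct OC as [w EO].
    assert (W : O = in_frame H C 0 (1 - w)).
    { rewrite EO; unfold in_frame; simpl; f_equal; ring. }
    rewrite W; f_equal; rewrite Hy, distance_sq, W.
    apply (Rmult_eq_reg_r (dot (vec H C) (vec H C))); [| lra].
    unfold Rdiv; rewrite Rmult_assoc, Rinv_l by lra.
    unfold in_frame, dot, vec; simpl; ring. }
  rewrite EB in LA1; rewrite EC in LA1 at 2.
  apply on_line_in_frame in LA1 as [s EA1].
  rewrite EA in LB1; rewrite EC in LB1 at 2.
  apply on_line_in_frame in LB1 as [r EB1].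
  rewrite EA, EA1 in OA; apply on_line_in_frame in OA as [t OA].
  rewrite EB, EB1 in OB; apply on_line_in_frame in OB as [u OB].
  rewrite EO in OA, OB.
  apply (in_frame_inj _ _ _ _ _ _ N) in OA as [OA1 OA2].
  apply (in_frame_inj _ _ _ _ _ _ N) in OB as [OB1 OB2].
  assert (Hs : s <> 0).
  { intros ->; apply NA1; rewrite EA1, EB; f_equal; ring. }
  apply distance_eq_iff_sq in ED.
  rewrite EA, EB, EA1, EB1, !distance_sq_in_frame in ED.
  apply Rmult_eq_reg_r in ED; [| lra].
  assert (AB2 : a ^ 2 = b ^ 2).
  { apply (cevians_in_frame a b y s t r u Hs); try lra.
    intro K0; apply NK; rewrite <- K0.
    transitivity (y ^ 3 + y * (e ^ 2 * (a ^ 2 + b ^ 2) - 1) + 2 * e ^ 2 * (a * b));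
      [ring | rewrite He; ring]. }
  apply distance_eq_iff_sq.
  assert (DC : forall x, distance (in_frame H C x 0) C ^ 2 =
                         (x ^ 2 + 1) * dot (vec H C) (vec H C)).
  { intro x; rewrite distance_sq; unfold in_frame, dot, vec; simpl; ring. }
  rewrite EA, EB, !DC; f_equal; lra.
Qed.
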